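(* Let $H$ be Hall's universal group. For every positive integer $m$ we have $T(D_{2m}, H) = \infty$. Consequently, $H$ does not have finite big Ramsey degrees.
   Context: Hall's universal group $H$ is the Fraïssé limit of the class of all finite groups: the (unique up to isomorphism) countable locally finite group that embeds every finite group and in which every isomorphism between two finite subgroups extends to an automorphism of $H$. For a positive integer $n$, $D_n$ denotes the dihedral group with $2n$ elements, $D_n = \langle a, b \mid a^2 = 1, b^2 = 1, (ab)^n = (ba)^n = 1\rangle$; so $D_{2m}$ has $4m$ elements, and $D_2 \cong C_2 \times C_2$. For first-order structures $A, B$ of the same signature, $\mathrm{Emb}(A,B)$ denotes the set of all embeddings $A \hookrightarrow B$ (for groups: injective homomorphisms). Let $A$ be a finite structure and $S$ a locally finite structure. The big Ramsey degree $T(A,S)$ of $A$ in $S$ is the least positive integer $n$, if it exists, such that for every positive integer $k$ and every coloring $\chi : \mathrm{Emb}(A,S) \to \{0,\dots,k-1\}$ there is $w \in \mathrm{Emb}(S,S)$ with $|\chi(w \circ \mathrm{Emb}(A,S))| \le n$, where $w \circ \mathrm{Emb}(A,S) = \{w \circ f : f \in \mathrm{Emb}(A,S)\}$. If no such $n$ exists, write $T(A,S) = \infty$. The structure $S$ has finite big Ramsey degrees if $T(A,S) < \infty$ for every finitely generated substructure $A$ of $S$. *)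

(* Defs.v *)
From HB Require Import structures.
From mathcomp Require Import all_boot all_fingroup all_solvable.
From mathcomp Require Import boolp classical_sets functions cardinality.

Set Implicit Arguments.
Unset Strict Implicit.
Unset Printing Implicit Defensive.

Local Open Scope classical_set_scope.
Local Open Scope card_scope.
Local Open Scope group_scope.

(* Groups may be infinite: [groupType]. In the language of groups the         *)
(* substructures of [S] are its subgroups, here [P : groupClosed S], and      *)
(* [subgroup P] is the corresponding group.                                   *)
Record subgroup (S : groupType) (P : groupClosed S) := Subgroup {
  subgroup_val :> S;
  _ : subgroup_val \in P
}.

HB.instance Definition _ (S : groupType) (P : groupClosed S) :=
  [isSub for @subgroup_val S P].
HB.instance Definition _ (S : groupType) (P : groupClosed S) :=
  [Choice of subgroup P by <:].

Lemma subgroup_closed (S : groupType) (P : groupClosed S) :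
  group_closed (fun x : S => x \in P).
Proof. by split=> [|x y Px Py]; [apply: gpred1 | apply: gpredF]. Qed.

HB.instance Definition _ (S : groupType) (P : groupClosed S) :=
  SubChoice_isSubGroup.Build S _ (subgroup P) (subgroup_closed P).

Definition generated_by (S : groupType) (P : groupClosed S) (s : seq S) :=
  {subset s <= P} /\
  (forall Q : groupClosed S, {subset s <= Q} -> {subset P <= Q}).

Definition finitely_generated (S : groupType) (P : groupClosed S) :=
  exists s : seq S, generated_by P s.

Definition locally_finite (S : groupType) :=
  forall P : groupClosed S, finitely_generated P -> finite_set [set` P].

(* A multiplicative map between groups preserves 1 and inverses.              *)
Record embedding (A B : groupType) := Embedding {
  emb_hom :> {multiplicative A -> B};
  emb_inj : injective emb_hom
}.

Definition emb_comp (A B C : groupType) (w : embedding B C)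
    (f : embedding A B) : embedding A C :=
  @Embedding A C (w \o f : A -> C) (inj_comp (@emb_inj _ _ w) (@emb_inj _ _ f)).

Definition isomorphisms_extend (H : groupType) :=
  forall (P Q : groupClosed H) (phi : {multiplicative subgroup P -> subgroup Q}),
    finite_set [set` P] -> finite_set [set` Q] -> bijective phi ->
    exists2 alpha : {multiplicative H -> H},
      bijective alpha & forall x : subgroup P, alpha (\val x) = \val (phi x).

Record Hall_universal (H : groupType) : Prop := {
  Hall_countable : countable [set: H];
  Hall_locally_finite : locally_finite H;
  Hall_embeds_finite : forall G : finGroupType, inhabited (embedding G H);
  Hall_isomorphisms_extend : isomorphisms_extend H
}.

(* ['D_k] is the dihedral group of order [k], but only for even [k >= 4]; so  *)
(* this is the dihedral group with [2 n] elements for [n >= 2] only.          *)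
Definition dihedral (n : nat) : finGroupType := ('D_(n.*2))%type.

Lemma dihedral_presentation n : (1 < n)%N ->
  'D_(n.*2) \isog Grp (a : b : a ^+ 2, b ^+ 2, (a * b) ^+ n, (b * a) ^+ n).
Proof.
move=> n_gt1 gT G; rewrite Grp'_dihedral //.
apply: eq_existsb => -[a b]; rewrite /= !xpair_eqE; congr (_ && _).
apply: andb_id2l => _; apply: andb_id2l => _.
have -> : b * a = (a * b) ^ a by rewrite /conjg !mulgA mulVg mul1g.
by rewrite -conjXg conjg_eq1 andbb.
Qed.

Definition ramsey_bound (A S : groupType) (n : nat) :=
  (0 < n)%N /\
  forall (k : nat) (chi : embedding A S -> 'I_k), (0 < k)%N ->
    exists w : embedding S S,
      chi @` [set emb_comp w f | f in [set: embedding A S]] #<= `I_n.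

(* [T(A, S)], where [None] stands for infinity.                               *)
Definition big_ramsey_degree (A S : groupType) : option nat :=
  if pselect (exists n, `[< ramsey_bound A S n >]) is left ex
  then Some (ex_minn ex) else None.

Definition finite_big_ramsey_degrees (S : groupType) :=
  forall P : groupClosed S, finitely_generated P ->
    big_ramsey_degree (subgroup P) S <> None.

(* Main.v *)
Require Import Defs.
From HB Require Import structures.
From mathcomp Require Import all_boot all_fingroup all_solvable.
From mathcomp Require Import boolp classical_sets functions cardinality filter.

(** Colouring idea. Write [H] as an increasing union of finite subgroups [K i]
    and choose compatible retractions [p i] of the set [H] onto [K i] that
    commute with right multiplication by [K i] ([tower_projection]): they are
    given by nested left transversals and are not homomorphisms. For a pair
    [(a, b)] consider the two sequences [(p i b)^-1 * p i (a * b)] and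
    [(p i a)^-1 * p i (a * b)], indexed by [i], and let [osc] count how often a
    jump of the first is followed by a jump of the second. An embedding [f] of
    the dihedral group is coloured by [osc (f a) (f b)] modulo [k], where [a]
    and [b] are suitable elements of the group. All [k] colours survive in every
    copy [w(H)] of [H] in itself, for the following reason.

    Take commuting involutions [z 0], [z 1], and so on in [w(H)], of rapidly
    growing rank in the tower, split them between [a] and [b], and multiply
    these products into a fixed copy of the dihedral group commuting with the
    [z n]. If the [p i] of all relevant tails of the products agree with one
    limit [q i], then a factor [z n] put into [a] makes only the first sequence
    jump between the ranks of [z n.-1] and [z n], and a factor put into [b] only
    the second ([switches_block]). So [osc] is a constant plus the number of
    alternations prescribed by the splitting ([osc_words]), and it takes any
    number of consecutive values.

    The agreement of the tails is a recurrence property, as in the proof of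
    Hindman's theorem: it holds along an idempotent ultrafilter
    ([idempotent_ultrafilter], [tower_limit]). The ultrafilter can be taken to
    contain, for every finite list [s], the image under [w] of the involutions
    that centralize [s] and lie outside the subgroup generated by [s]
    ([involutions_ultrafilter]). These involutions exist because every finite
    subgroup [P] of [H] extends inside [H] to a copy of the direct product of
    [P] and [C_2] ([Hall_new_involution]).

    The dihedral group enters only through the homomorphisms [mu] and [nu] to
    [Z/2] that separate the elements [a] and [b]; they exist because [D_n] maps
    onto the Klein four-group when [n] is even ([dihedral_klein]). With two
    commuting involutions [u] and [v] as above, an embedding [f] can be twisted
    to [u ^+ mu x * v ^+ nu x * f x] ([twisted_embedding]). The failure of
    finiteness for [H] is witnessed by the image of [D_2] in [H]. *)

Set Implicit Arguments.
Unset Strict Implicit.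
Unset Printing Implicit Defensive.

Local Open Scope classical_set_scope.
Local Open Scope group_scope.

(** * Idempotent ultrafilters on a semigroup *)

(** The product of ultrafilters, extended to arbitrary set systems. The inner
    variable multiplies on the left, so this is the usual product of the
    opposite semigroup; the tower projections below respect multiplication on
    the right, which dictates this choice. *)
Definition filter_mul (S : semigroupType) (F E : set_system S) : set_system S :=
  [set A | F [set x | E [set y | A (y * x)]]].

Lemma filter_mul_filter (S : semigroupType) (F E : set_system S) :
  ProperFilter F -> ProperFilter E -> ProperFilter (filter_mul F E).
Proof.
move=> PF PE; apply: Build_ProperFilter_ex.
  move=> A FA; have [x Ex] := @filter_ex _ F _ _ FA.
  have [y Ayx] := @filter_ex _ E _ _ Ex.
  by exists (y * x).
split.
- by apply: (@filterS _ F _ setT) => [x _|]; exact: filterT.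
- move=> A B FA FB; apply: filterS (@filterI _ F _ _ _ FA FB) => x [Ax Bx].
  exact: filterS (filterI Ax Bx).
- by move=> A B AB; apply: (@filterS _ F) => x; apply: filterS => y; exact: AB.
Qed.

Lemma filter_mulS (S : semigroupType) (F F' E E' : set_system S) :
  ProperFilter F' -> F `<=` F' -> E `<=` E' ->
  filter_mul F E `<=` filter_mul F' E'.
Proof.
by move=> PF FF' EE' A /FF'; apply: filterS => x /EE'.
Qed.

Lemma filter_mulA (S : semigroupType) (F E D : set_system S) :
  filter_mul F (filter_mul E D) = filter_mul (filter_mul F E) D.
Proof.
apply/funext => A; congr F; apply/funext => x; congr E; apply/funext => z.
by congr D; apply/funext => y /=; rewrite mulgA.
Qed.

(** The proper filters contained in their own square. The closed set of the
    ultrafilters above such a filter is a subsemigroup. *)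
Definition mul_filter (S : semigroupType) (F : set_system S) :=
  ProperFilter F /\ F `<=` filter_mul F F.

Lemma bigcup_mul_filter (S : semigroupType) (C : set (set_system S))
    (F : set_system S) : C F -> (forall E, C E -> mul_filter E) ->
  total_on C subset -> mul_filter (\bigcup_(E in C) E).
Proof.
move=> CF mC totC; split; last first.
  move=> A [E CE EA]; have [PE EE] := mC E CE.
  exists E => //; apply: (@filterS _ E _ _ _ _ (EE _ EA)) => x Ex /=.
  by exists E.
apply: Build_ProperFilter_ex.
  by move=> A [E CE EA]; have [PE _] := mC E CE; exact: filter_ex EA.
split.
- by exists F => //; have [PF _] := mC F CF; exact: filterT.
- move=> A B [E CE EA] [D CD DB].
  have [PE _] := mC E CE; have [PD _] := mC D CD.
  have [ED|DE] := totC E D CE CD.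
    by exists D => //; apply: filterI => //; exact: ED.
  by exists E => //; apply: filterI => //; exact: DE.
- move=> A B AB [E CE EA]; exists E => //.
  by have [PE _] := mC E CE; exact: filterS EA.
Qed.

(** Zorn's lemma. *)
Lemma maximal_mul_filter (S : semigroupType) (F0 : set_system S) :
  mul_filter F0 -> exists2 F : set_system S, mul_filter F /\ F0 `<=` F &
    forall E, mul_filter E -> F `<=` E -> E = F.
Proof.
move=> mF0.
(* The empty system is admitted so that the empty chain has an upper bound. *)
pose P := [set F : set_system S | F = set0 \/ mul_filter F /\ F0 `<=` F].
have [|F [PF Fmax]] := @Zorn_bigcup _ P.
  move=> C CP totC.
  have [[E [CE E0]]|noE] := pselect (exists E, C E /\ E <> set0); last first.
    left; apply/seteqP; split=> // A [E CE EA].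
    by case: noE; exists E; split=> // E0; rewrite E0 in EA.
  right; have -> : \bigcup_(D in C) D = \bigcup_(D in C `\ set0) D.
    apply/seteqP; split=> A [D CD DA]; last by exists D => //; case: CD.
    by exists D => //; split=> // D0; rewrite D0 in DA.
  have CE0 : (C `\ set0) E by split.
  have good D : (C `\ set0) D -> mul_filter D /\ F0 `<=` D.
    by move=> [CD D0]; have [//|] := CP D CD.
  split.
    apply: (bigcup_mul_filter CE0) => [D /good[]//|D D' [CD _] [CD' _]].
    exact: totC.
  by move=> A F0A; exists E => //; apply: (good E CE0).2.
have F0P : P F0 by right; split.
case: PF => [F_eq0|[mF F0F]].
  have [] := Fmax F0 _ F0P; rewrite F_eq0 properEneq; split=> //.
  apply/eqP => F00; have [PF0 _] := mF0.
  by have : F0 setT by [exact: filterT]; rewrite -F00.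
exists F => // E mE FE; apply: contrapT => EF.
apply: (Fmax E); first by rewrite properEneq; split=> //; apply/eqP => /esym.
by right; split=> //; exact: subset_trans FE.
Qed.

(** Ellis' theorem, in Papazyan's form for filters. Let [F] be maximal and [r] an
    ultrafilter above [F]. Maximality is applied twice: to the product of [F]
    and [r], which gives [filter_mul F r = F], and then to the filter generated
    by [F] and the sets, one for each member [B] of [r], of those [x] such that
    [y * x] lies in [B] for [r]-most [y].
    For ultrafilters the inclusion of [r] in its square is idempotence. *)
Lemma idempotent_ultrafilter (S : semigroupType) (F0 : set_system S) :
  mul_filter F0 ->
  exists r, [/\ UltraFilter r, F0 `<=` r & r `<=` filter_mul r r].
Proof.
move=> /maximal_mul_filter[F [[PF FF] F0F] Fmax].
have [r [Ur Fr]] := ultraFilterLemma PF.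
have Pr : ProperFilter r by case: Ur.
exists r; split=> //; first exact: subset_trans Fr.
have PFF := filter_mul_filter PF PF; have PrF := filter_mul_filter Pr PF.
have Fr_eq : filter_mul F r = F.
  apply: Fmax; last by apply: subset_trans FF _; exact: filter_mulS.
  split; first exact: filter_mul_filter.
  apply: (@subset_trans _ (filter_mul (filter_mul F F) r)).
    exact: filter_mulS.
  rewrite -!filter_mulA; apply: filter_mulS => //.
  rewrite filter_mulA; apply: filter_mulS => //.
  by apply: subset_trans FF _; exact: filter_mulS.
pose D (B : set S) := [set x | r [set y | B (y * x)]].
pose E := [set A | exists2 B, r B & exists2 C, F C & C `&` D B `<=` A].
have DI B B' : D (B `&` B') = D B `&` D B'.
  apply/seteqP; split=> x /=; last by case=> *; exact: filterI.
  by move=> rx; split; apply: filterS rx => y [].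
have EF : E = F.
  apply: Fmax; last first.
    by move=> A FA; exists setT; [exact: filterT|exists A => // x []].
  split.
    apply: Build_ProperFilter_ex.
      move=> A [B rB [C FC CDA]]; apply: contrapT => A0.
      (* Otherwise [C] witnesses that the complement of [B] is in [F * r = F],
         hence in [r]. *)
      have [] := @filter_ex _ r _ (B `&` ~` B); last by move=> x [].
      apply: filterI => //; apply: Fr; rewrite -Fr_eq.
      apply: filterS FC => x Cx; have [//|/= rx] :=
        in_ultra_setVsetC (~` [set y | B (y * x)]) Ur.
      rewrite setCK in rx.
      by case: A0; exists x; apply: CDA.
    split.
    - by exists setT; [exact: filterT|exists setT => //; exact: filterT].
    - move=> A A' [B rB [C FC CDA]] [B' rB' [C' FC' CDA']].
      exists (B `&` B'); first exact: filterI.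
      exists (C `&` C'); first exact: filterI.
      by rewrite DI => x [[Cx C'x] [Dx D'x]]; split; [apply: CDA|apply: CDA'].
    - move=> A A' AA' [B rB [C FC CDA]]; exists B => //; exists C => //.
      exact: subset_trans AA'.
  move=> A [B rB [C FC CDA]]; exists B => //.
  exists [set x | F [set y | C (y * x)]]; first exact: FF.
  move=> x [/= Cx Dx]; exists [set y | B (y * x)] => //.
  exists [set y | C (y * x)] => // y [/= Cyx Dyx]; apply: CDA; split=> //.
  rewrite /D /= in Dyx *.
  by under eq_set do rewrite mulgA.
move=> B rB; apply: Fr; rewrite -EF; exists B => //.
by exists setT; [exact: filterT|move=> x []].
Qed.

(** * Projections onto a tower of subgroups *)

(** Compatible retractions [p i] of the set [G] onto the subgroups [K i], each
    equivariant for right multiplication by [K i]. *)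
Record tower_projection (G : groupType) (K : nat -> groupClosed G)
    (p : nat -> G -> G) : Prop := {
  proj_in : forall i x, p i x \in K i;
  projM : forall i x g, g \in K i -> p i (x * g) = p i x * g;
  proj_proj : forall i j x, (i <= j)%N -> p i (p j x) = p i x;
  proj_id : forall i x, x \in K i -> p i x = x
}.

Section TowerProjection.
Variables (G : groupType) (K : nat -> groupClosed G).
Hypothesis Kmono : forall i j, (i <= j)%N -> {subset K i <= K j}.
Hypothesis Kexh : forall x, exists i, x \in K i.

(* The retraction on one level: every left coset of [K i] has a chosen
   representative, which is [1] for [K i] itself, and [sigma i x] is the
   quotient of [x] by the representative of its coset. *)
Let sigma i x : G :=
  if x \in K i then x else (choose (fun y => y^-1 * x \in K i) x)^-1 * x.

Let sigma_in i x : sigma i x \in K i.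
Proof.
rewrite /sigma; case: ifPn => // _.
by apply: (@chooseP _ (fun y => y^-1 * x \in K i)); rewrite mulVg gpred1.
Qed.

Let sigma_id i x : x \in K i -> sigma i x = x.
Proof. by rewrite /sigma => ->. Qed.

Let sigmaM i x g : g \in K i -> sigma i (x * g) = sigma i x * g.
Proof.
move=> Kg; rewrite /sigma gpredMr //; case: ifP => // _.
rewrite mulgA; congr (_ ^-1 * _ * _).
rewrite (@eq_choose _ _ (fun y => y^-1 * x \in K i)) => [|y]; last first.
  by rewrite mulgA gpredMr.
by apply: choose_id; rewrite ?mulVg ?gpred1 // invgM -mulgA mulVg mulg1 gpredV.
Qed.

(* The composite of [sigma i], up to [sigma (i + d).-1]. On a given [x] it does
   not depend on [d] as soon as [x] is in [K (i + d)]. *)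
Let Fixpoint comp i d x : G :=
  if d is d'.+1 then sigma i (comp i.+1 d' x) else x.

Let comp_id i d x : x \in K i -> comp i d x = x.
Proof.
elim: d i => //= d IH i Kx; rewrite IH ?sigma_id //.
exact: Kmono Kx.
Qed.

Let compD i d e x : comp i (d + e) x = comp i d (comp (i + d) e x).
Proof. by elim: d i => [|d IH] i /=; rewrite ?addn0 // IH addnS. Qed.

Let compM i d x g : g \in K i -> comp i d (x * g) = comp i d x * g.
Proof.
elim: d i => //= d IH i Kg; rewrite IH ?sigmaM //.
exact: Kmono Kg.
Qed.

Let comp_in i d x : x \in K (i + d)%N -> comp i d x \in K i.
Proof. by case: d => [|d] /=; rewrite ?addn0 // sigma_in. Qed.

Lemma tower_projection_exists : exists p, tower_projection K p.
Proof.
have [rk rkP] := choice Kexh.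
have rkD i d x : (rk x <= d)%N -> x \in K (i + d)%N.
  by move=> le; apply: Kmono (rkP x); rewrite (leq_trans le) ?leq_addl.
pose p i x := comp i (rk x) x.
have pE i d x : x \in K (i + d)%N -> p i x = comp i d x.
  move=> Kx; have <- : comp i (d + rk x) x = comp i d x.
    by rewrite compD (comp_id _ Kx).
  by rewrite addnC compD [comp (i + _) _ _]comp_id // rkD.
exists p; split=> [i x|i x g Kg|i j x /subnKC <-|i x Kx].
- by apply: comp_in; exact: rkD.
- pose d := maxn (rk x) (rk (x * g)).
  by rewrite !(pE i d) ?rkD ?leq_maxl ?leq_maxr // compM.
- have pj : p (i + (j - i))%N x \in K (i + (j - i))%N.
    by apply: comp_in; exact: rkD.
  rewrite (pE _ _ _ pj) (pE i (j - i + rk x)%N) ?compD //.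
  by rewrite addnA rkD.
- by rewrite (pE i 0) // addn0.
Qed.
End TowerProjection.

(** * Counting alternations of jumps *)

Section Switches.
Variable T : eqType.
Implicit Types (f g : nat -> T) (st : bool * nat).

(** One step of an automaton that counts how often a jump of [f] is followed by a
    jump of [g]. The boolean of the state tells whether the last jump was one of
    [f]; the number is the count. *)
Definition switch_step f g st i :=
  if f i != f i.+1 then (true, st.2)
  else if g i != g i.+1 then (false, st.1 + st.2)%N else st.

Definition switches f g st lo hi :=
  foldl (switch_step f g) st (index_iota lo hi).

Lemma switches_cat f g st lo mid hi : (lo <= mid <= hi)%N ->
  switches f g st lo hi = switches f g (switches f g st lo mid) mid hi.
Proof.
case/andP=> lm mh; rewrite /switches -foldl_cat.
by rewrite /index_iota -(subnKC lm) addKn -iotaD subnDA subnKC // leq_sub2r.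
Qed.

Lemma eq_switches f g f' g' st lo hi :
  (forall i, (lo <= i < hi)%N -> (f i != f i.+1) = (f' i != f' i.+1)) ->
  (forall i, (lo <= i < hi)%N -> (g i != g i.+1) = (g' i != g' i.+1)) ->
  switches f g st lo hi = switches f' g' st lo hi.
Proof.
move=> ff gg; rewrite /switches.
have : {subset index_iota lo hi <= index_iota lo hi} by [].
elim: {1 3 4}(index_iota lo hi) st => //= i s IH st sub.
have /[!mem_index_iota] lih := sub i (mem_head _ _).
rewrite [in RHS]/switch_step -ff -?gg // IH // => k ks.
by apply: sub; rewrite inE ks orbT.
Qed.

Lemma switches_shift f g b n lo hi :
  (switches f g (b, n) lo hi).2 = ((switches f g (b, 0) lo hi).2 + n)%N.
Proof.
suff H st m : foldl (switch_step f g) (st.1, st.2 + m)%N (index_iota lo hi) =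
    ((foldl (switch_step f g) st (index_iota lo hi)).1,
     (foldl (switch_step f g) st (index_iota lo hi)).2 + m)%N.
  by rewrite /switches -[n in LHS]add0n (H (b, 0)).
elim: (index_iota lo hi) st => [|i s IH] st //=.
rewrite -IH; congr foldl; rewrite /switch_step /=.
by case: ifP => // _; case: ifP => //=; rewrite addnA.
Qed.

Let exists_change f lo hi : (lo <= hi)%N -> f lo != f hi ->
  has (fun i => f i != f i.+1) (index_iota lo hi).
Proof.
move=> lh; apply: contraNT => /hasPn noch.
suff H d : (lo + d <= hi)%N -> f (lo + d)%N = f lo.
  by rewrite -(H (hi - lo)%N) subnKC.
elim: d => [|d IH]; rewrite ?addn0 // addnS => ldh; rewrite -IH 1?ltnW //.
apply/esym/eqP; have := noch (lo + d)%N; rewrite negbK; apply.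
by rewrite mem_index_iota leq_addr.
Qed.

Lemma switches_left f g st lo hi : (lo <= hi)%N -> f lo != f hi ->
    (forall i, (lo <= i < hi)%N -> g i = g i.+1) ->
  switches f g st lo hi = (true, st.2).
Proof.
move=> lh /(exists_change lh) ch ng; rewrite /switches.
suff : foldl (switch_step f g) st (index_iota lo hi) =
    if has (fun i => f i != f i.+1) (index_iota lo hi)
    then (true, st.2) else st.
  by rewrite ch.
have : {subset index_iota lo hi <= index_iota lo hi} by [].
elim: {1 3 4}(index_iota lo hi) st => //= i s IH st sub.
have /[!mem_index_iota] lih := sub i (mem_head _ _).
rewrite IH => [|k ks]; last by apply: sub; rewrite inE ks orbT.
by rewrite /switch_step ng // eqxx; case: ifP => //=; case: ifP.
Qed.

Lemma switches_right f g st lo hi : (lo <= hi)%N -> g lo != g hi ->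
    (forall i, (lo <= i < hi)%N -> f i = f i.+1) ->
  switches f g st lo hi = (false, st.1 + st.2)%N.
Proof.
move=> lh /(exists_change lh) ch nf; rewrite /switches.
suff : foldl (switch_step f g) st (index_iota lo hi) =
    if has (fun i => g i != g i.+1) (index_iota lo hi)
    then (false, st.1 + st.2)%N else st.
  by rewrite ch.
have : {subset index_iota lo hi <= index_iota lo hi} by [].
elim: {1 3 4}(index_iota lo hi) st => //= i s IH st sub.
have /[!mem_index_iota] lih := sub i (mem_head _ _).
rewrite IH => [|k ks]; last by apply: sub; rewrite inE ks orbT.
by rewrite /switch_step nf // eqxx /=; case: ifP => //= _; case: ifP.
Qed.

Lemma switches_still f g st lo hi :
    (forall i, (lo <= i < hi)%N -> f i = f i.+1) ->
    (forall i, (lo <= i < hi)%N -> g i = g i.+1) ->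
  switches f g st lo hi = st.
Proof.
move=> nf ng; rewrite /switches.
have : {subset index_iota lo hi <= index_iota lo hi} by [].
elim: {1 3}(index_iota lo hi) st => //= i s IH st sub.
have /[!mem_index_iota] lih := sub i (mem_head _ _).
rewrite IH => [|k ks]; last by apply: sub; rewrite inE ks orbT.
by rewrite /switch_step nf // ng // !eqxx.
Qed.

End Switches.

(** * The oscillation of a pair of elements *)

Section Osc.
Variables (G : groupType) (K : nat -> groupClosed G) (p : nat -> G -> G).
Hypothesis pP : tower_projection K p.

(** When [a] and [b] are products of commuting elements of increasing rank, the
    first sequence jumps only at the factors of [a] and the second only at the
    factors of [b]. *)
Definition left_trace a b i := (p i b)^-1 * p i (a * b).
Definition right_trace a b i := (p i a)^-1 * p i (a * b).
(** The count is taken up to rank [N]; it does not depend on [N] once [a] and [b]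
    are in [K N] ([osc_stable]). *)
Definition osc a b N :=
  (switches (left_trace a b) (right_trace a b) (false, 0) 0 N).2.

Lemma osc_stable a b N N' : (forall i j, (i <= j)%N -> {subset K i <= K j}) ->
  a \in K N -> b \in K N -> (N <= N')%N -> osc a b N' = osc a b N.
Proof.
move=> Kmono KaN KbN NN'; rewrite /osc (@switches_cat _ _ _ _ 0 N) //.
have pid i x : (N <= i)%N -> x \in K N -> p i x = x.
  by move=> Ni Kx; apply: (proj_id pP); exact: Kmono Kx.
by rewrite [X in X.2]switches_still // => i /andP[Ni _];
  rewrite /left_trace /right_trace !pid ?gpredM // leqW.
Qed.

(** The product of [c] by the [z m] with [S m] and [m < n], the larger indices on
    the left. *)
Fixpoint select (z : nat -> G) (S : nat -> bool) c n :=
  if n is n'.+1 then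
    (if S n' then z n' * select z S c n' else select z S c n')
  else c.

(** A sequence [z] whose term [z n] occupies the ranks from [rho n] to
    [rho n.+1]. At rank [rho n] it cannot be distinguished from the limit [q],
    and neither can [q (rho n.+1) * z n]. *)
Record block_sequence (q : nat -> G) (rho : nat -> nat) (z : nat -> G) : Prop :=
{
  block_mono : forall n, (rho n <= rho n.+1)%N;
  block_in : forall n, z n \in K (rho n.+1);
  block_lim : forall n, p (rho n) (z n) = q (rho n);
  block_ret : forall n, p (rho n) (q (rho n.+1) * z n) = q (rho n);
  block_neq1 : forall n, z n != 1;
  block_comm : forall m n, commute (z m) (z n)
}.

Lemma commute_select (z : nat -> G) S c y n :
  (forall m, commute y (z m)) -> commute y c -> commute y (select z S c n).
Proof.
by move=> yz yc; elim: n => //= n IH; case: (S n) => //; exact: commuteM.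
Qed.

Section Blocks.
Variables (q : nat -> G) (rho : nat -> nat) (z : nat -> G).
Hypothesis Kmono : forall i j, (i <= j)%N -> {subset K i <= K j}.
Hypothesis q_coh : forall i j, (i <= j)%N -> p i (q j) = q i.
Hypothesis zP : block_sequence q rho z.

Let rho_mono m n : (m <= n)%N -> (rho m <= rho n)%N.
Proof. exact: (homo_leq leqnn leq_trans (block_mono zP)). Qed.

Section Select.
Variables (S : nat -> bool) (c : G).
Hypothesis c_in : c \in K (rho 0).

Lemma select_in n : select z S c n \in K (rho n).
Proof.
elim: n => //= n IH; have K' := Kmono (block_mono zP n) IH.
by case: (S n) => //; rewrite gpredM // (block_in zP).
Qed.

(** As [t] looks like [q] at rank [rho M], all the factors of rank above
    [rho n.+1] are absorbed by [q]. *)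
Lemma proj_select_block t M n i : p (rho M) t = q (rho M) -> (n < M)%N ->
    (rho n <= i <= rho n.+1)%N ->
  p i (t * select z S c M) =
    (if S n then p i (q (rho n.+1) * z n) else q i) * select z S c n.
Proof.
move=> ptq nM /andP[ni iSn].
suff H d m : p (rho (m + d)%N) t = q (rho (m + d)%N) ->
    p (rho m) (t * select z S c (m + d)%N) = q (rho m) * select z S c m.
  have Sin := Kmono ni (select_in n).
  have := H (M - n.+1)%N n.+1; rewrite subnKC // => /(_ ptq) {}H.
  rewrite -(proj_proj pP _ iSn) H /=.
  by case: (S n); rewrite ?mulgA [LHS](projM pP) // q_coh.
elim: d m => [|d IH] m; first by rewrite addn0 (projM pP) ?select_in // => ->.
rewrite addnS -addSn => /IH {}IH.
rewrite -(proj_proj pP _ (block_mono zP m)) IH /=.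
case: (S m); rewrite ?mulgA [LHS](projM pP) ?select_in ?(block_ret zP) //.
by rewrite q_coh // (block_mono zP).
Qed.

Lemma proj_select t M n : p (rho M) t = q (rho M) -> (n <= M)%N ->
  p (rho n) (t * select z S c M) = q (rho n) * select z S c n.
Proof.
move=> ptq; rewrite leq_eqVlt => /predU1P[->|nM].
  by rewrite (projM pP) ?ptq // select_in.
rewrite (proj_select_block ptq nM) ?leqnn ?(block_mono zP) //.
by rewrite (block_ret zP) if_same.
Qed.

End Select.

(** The factors selected by [S] and by its complement recombine to all of them. *)
Lemma select_mul S c d n : (forall m, commute (z m) c) ->
  select z S c n * select z (negb \o S) d n = select z xpredT (c * d) n.
Proof.
move=> zc; elim: n => //= n <-; case: (S n) => /=; rewrite !mulgA //.
by rewrite (commute_select _ _ (block_comm zP n) (zc n)).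
Qed.

Variables (a0 b0 : G) (M : nat).
Hypothesis a0_in : a0 \in K (rho 0).
Hypothesis b0_in : b0 \in K (rho 0).
Hypothesis za0 : forall n, commute (z n) a0.

(** Each [z n] with [n < M] goes to the left word if [S n] holds and to the right
    word otherwise. The top factors [z M] and [z M.+1] do not depend on [S]; they
    ensure that the left word, the right word and their product all look like
    [q] at rank [rho M]. *)
Definition left_word S := z M * select z S a0 M.
Definition right_word S := z M.+1 * select z (negb \o S) b0 M.

Let ab0_in : a0 * b0 \in K (rho 0). Proof. exact: gpredM. Qed.

Let words_mul S : left_word S * right_word S =
  (z M.+1 * z M) * select z xpredT (a0 * b0) M.
Proof.
rewrite /left_word /right_word -(select_mul S) // !mulgA; congr (_ * _).
rewrite -[RHS]mulgA; apply/esym/commuteM; first exact: block_comm zP _ _.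
by apply: commute_select => // n; exact: block_comm zP _ _.
Qed.

Let lim_left : p (rho M) (z M) = q (rho M). Proof. exact: block_lim zP M. Qed.

Let lim_right : p (rho M) (z M.+1) = q (rho M).
Proof.
rewrite -(proj_proj pP _ (block_mono zP M)) (block_lim zP).
by rewrite q_coh // (block_mono zP).
Qed.

Let lim_mul : p (rho M) (z M.+1 * z M) = q (rho M).
Proof.
rewrite -(proj_proj pP _ (block_mono zP M)) (projM pP) ?(block_in zP) //.
by rewrite (block_lim zP) (block_ret zP).
Qed.

Let word_switches S := switches (left_trace (left_word S) (right_word S))
  (right_trace (left_word S) (right_word S)).

(* Below [rho 0] and above [rho M] the jumps do not depend on [S]. *)
Let switches_low S S' st :
  word_switches S st 0 (rho 0) = word_switches S' st 0 (rho 0).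
Proof.
have low T c t i :
    c \in K (rho 0) -> p (rho M) t = q (rho M) -> (i <= rho 0)%N ->
    p i (t * select z T c M) = p i (q (rho 0) * c).
  by move=> Kc tq i0; rewrite -(proj_proj pP _ i0) (proj_select _ Kc tq).
by apply: eq_switches => i /andP[_ i0];
  rewrite /left_trace /right_trace !words_mul !low // ltnW.
Qed.

(* Key computation: the block of [z n] contributes jumps of one kind only, and at
   least one of them since [z n != 1]. *)
Let switches_block S st n : (n < M)%N ->
  word_switches S st (rho n) (rho n.+1) =
    if S n then (true, st.2) else (false, st.1 + st.2)%N.
Proof.
move=> nM; pose A := select z S a0 n; pose B := select z (negb \o S) b0 n.
have pA i := proj_select_block S a0_in lim_left nM (i:=i).
have pB i := proj_select_block (negb \o S) b0_in lim_right nM (i:=i).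
have pC i := proj_select_block xpredT ab0_in lim_mul nM (i:=i).
have AB : select z xpredT (a0 * b0) n = A * B by rewrite -(select_mul S).
have rn := block_mono zP n.
have zAB : z n * A = A * z n.
  by apply: commute_select => // k; exact: block_comm zP _ _.
have qzK : p (rho n.+1) (q (rho n.+1) * z n) = q (rho n.+1) * z n.
  rewrite (projM pP) ?(block_in zP) // -(block_lim zP).
  by rewrite (proj_id pP) ?(proj_in pP).
have lo : (rho n <= rho n <= rho n.+1)%N by rewrite leqnn.
have hi : (rho n <= rho n.+1 <= rho n.+1)%N by rewrite leqnn rn.
have inK i : (rho n <= i < rho n.+1)%N -> (rho n <= i <= rho n.+1)%N /\
    (rho n <= i.+1 <= rho n.+1)%N.
  by case/andP=> ni iSn; rewrite ni ltnW // iSn leqW.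
have mulKV (x u v : G) : (x * u)^-1 * (x * v) = u^-1 * v.
  by rewrite invgM -mulgA mulKg.
case: ifP => Sn.
  apply: switches_left => // [|i /inK[iK SiK]].
    rewrite /left_trace words_mul !pB // !pC //= Sn (block_ret zP) AB qzK.
    rewrite -[_ * z n * _]mulgA !mulKV (inj_eq (mulgI _)).
    by rewrite -{1}[A * B]mul1g (inj_eq (mulIg _)) eq_sym (block_neq1 zP).
  by rewrite /right_trace words_mul !pA // !pC // AB Sn !mulKV.
apply: switches_right => // [|i /inK[iK SiK]].
  rewrite /right_trace words_mul !pA // !pC //= Sn (block_ret zP) AB qzK.
  rewrite -[_ * z n * _]mulgA !mulKV (inj_eq (mulgI _)).
  by rewrite -{1}[A * B]mul1g (inj_eq (mulIg _)) eq_sym (block_neq1 zP).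
by rewrite /left_trace words_mul !pB // !pC //= AB Sn /= !mulKV.
Qed.

Let switches_high S S' st N :
  word_switches S st (rho M) N = word_switches S' st (rho M) N.
Proof.
have KM T c i : c \in K (rho 0) -> (rho M <= i)%N -> select z T c M \in K i.
  by move=> Kc Mi; exact: Kmono Mi _ (select_in T Kc M).
have conj (x y u v : G) : ((x * u)^-1 * (y * v) = u^-1 * (x^-1 * y) * v).
  by rewrite invgM !mulgA.
by apply: eq_switches => i /andP[Mi _]; have SMi := leqW Mi;
  rewrite /left_trace /right_trace !words_mul /left_word /right_word;
  move: (z M.+1 * z M) => e; rewrite !(projM pP) ?KM // !conj;
  rewrite !(inj_eq (mulIg _)) !(inj_eq (mulgI _)).
Qed.

(** The splitting with exactly [j] alternations: even indices go left, odd indices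
    go right as long as they are smaller than [2 * j]. *)
Definition pattern j n := ~~ odd n || (j.*2 <= n)%N.

Let switches_pairs j k st : (k.*2 <= M)%N ->
  exists b, word_switches (pattern j) st (rho 0) (rho k.*2) =
            (b, st.2 + minn j k)%N.
Proof.
elim: k => [|k IH] kM.
  exists st.1.
  rewrite /word_switches /switches /index_iota subnn minn0 addn0 /=.
  by case: st.
rewrite doubleS in kM *.
have [|b st_k] := IH; first exact: ltnW (ltnW kM).
have r0 : (rho 0 <= rho k.*2)%N by exact: rho_mono.
have r1 := block_mono zP k.*2; have r2 := block_mono zP k.*2.+1.
exists (j <= k)%N; rewrite /word_switches.
rewrite (@switches_cat _ _ _ _ _ (rho k.*2)) ?r0 ?(leq_trans r1) //.
rewrite (@switches_cat _ _ _ _ _ (rho k.*2.+1)) ?r1 //.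
move: st_k; rewrite /word_switches => ->; rewrite -/(word_switches _).
have kM' := ltnW kM; rewrite !switches_block // /pattern /=.
rewrite odd_double /=.
rewrite leq_Sdouble.
case: ifP => [jk|/negbT] /=; last rewrite -ltnNge => jk.
  by rewrite (minn_idPl jk) (minn_idPl (leqW jk)).
by rewrite (minn_idPr jk) (minn_idPr (ltnW jk)) addnCA add1n.
Qed.

(** As [M] is odd, the last block [z M.-1] always goes left, so that the automaton
    enters the top zone with the same boolean for all [j]. *)
Lemma osc_words k N : M = k.*2.+1 -> (rho M <= N)%N ->
  exists c, forall j, (j <= k)%N ->
    osc (left_word (pattern j)) (right_word (pattern j)) N = (c + j)%N.
Proof.
move=> Mk MN.
pose st0 := word_switches (pattern 0) (false, 0) 0 (rho 0).
exists ((word_switches (pattern 0) (true, 0) (rho M) N).2 + st0.2)%N => j jk.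
have r0M : (rho 0 <= rho M)%N by exact: rho_mono.
rewrite /osc -/(word_switches _ _ _ _) /word_switches.
rewrite (@switches_cat _ _ _ _ _ (rho 0)) ?(leq_trans r0M) //.
rewrite (@switches_cat _ _ _ _ _ (rho M)) ?r0M //.
rewrite -!/(word_switches _ _ _ _) (switches_low _ (pattern 0)) -/st0.
have -> : word_switches (pattern j) st0 (rho 0) (rho M) = (true, st0.2 + j)%N.
  have kM : (k.*2 < M)%N by rewrite Mk.
  have [b] := switches_pairs j st0 (ltnW kM); rewrite (minn_idPl jk) => st_k.
  have -> : rho M = rho k.*2.+1 by rewrite Mk.
  rewrite /word_switches (@switches_cat _ _ _ _ _ (rho k.*2)).
    move: st_k; rewrite /word_switches => ->; rewrite -/(word_switches _).
    by rewrite switches_block // /pattern odd_double.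
  by rewrite !rho_mono.
by rewrite (switches_high _ (pattern 0)) /word_switches switches_shift addnA.
Qed.
End Blocks.
End Osc.

(** * Generated subgroups, images and finite groups *)

Definition generated (G : groupType) (s : seq G) : {pred G} :=
  fun x => `[< forall Q : groupClosed G, {subset s <= Q} -> x \in Q >].

Section Generated.
Variables (G : groupType) (s : seq G).

Lemma generatedP x :
  reflect (forall Q : groupClosed G, {subset s <= Q} -> x \in Q)
    (x \in generated s).
Proof. exact: asboolP. Qed.

Let generated1 : 1 \in generated s.
Proof. by apply/generatedP => Q _; exact: gpred1. Qed.

Let generatedM : mulg_closed (generated s).
Proof.
by move=> x y /generatedP xs /generatedP ys; apply/generatedP => Q sQ;
  rewrite gpredM ?xs ?ys.
Qed.

Let generatedV : invg_closed (generated s).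
Proof.
by move=> x /generatedP xs; apply/generatedP => Q sQ; rewrite gpredV xs.
Qed.

HB.instance Definition _ := isMulClosed.Build G (generated s) generatedM.
HB.instance Definition _ := isMul1Closed.Build G (generated s) generated1.
HB.instance Definition _ := isInvClosed.Build G (generated s) generatedV.

End Generated.

Lemma generated_mem (G : groupType) (s : seq G) : {subset s <= generated s}.
Proof. by move=> x xs; apply/generatedP => Q; exact. Qed.

Lemma generatedS (G : groupType) (s t : seq G) :
  {subset s <= t} -> {subset generated s <= generated t}.
Proof.
move=> st x /generatedP xs; apply/generatedP => Q tQ.
by apply: xs => y /st/tQ.
Qed.

Lemma generated_finite (G : groupType) (s : seq G) :
  locally_finite G -> finite_set [set` generated s].
Proof.
move=> lfG; apply: (lfG (generated s)); exists s; split.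
  exact: generated_mem.
by move=> Q sQ x /generatedP; exact.
Qed.

Section GroupMorphism.
Variables (A B : groupType) (h : {multiplicative A -> B}).

Lemma mult1 : h 1 = 1.
Proof. by apply: (mulgI (h 1)); rewrite -gmulfM !mulg1. Qed.

Lemma multV x : h x^-1 = (h x)^-1.
Proof. by apply: (mulgI (h x)); rewrite -gmulfM !mulgV mult1. Qed.

End GroupMorphism.

Section Image.
Variables (A B : groupType) (h : {multiplicative A -> B}).

(** The image of a homomorphism, as a subgroup. *)
Definition image_pred : {pred B} := fun y => `[< exists x, y = h x >].

Lemma image_predP y : reflect (exists x, y = h x) (y \in image_pred).
Proof. exact: asboolP. Qed.

Lemma image_pred_mem x : h x \in image_pred.
Proof. by apply/image_predP; exists x. Qed.

Let image_pred1 : 1 \in image_pred.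
Proof. by rewrite -(mult1 h) image_pred_mem. Qed.

Let image_predM : mulg_closed image_pred.
Proof.
move=> _ _ /image_predP[x ->] /image_predP[y ->].
by rewrite -gmulfM image_pred_mem.
Qed.

Let image_predV : invg_closed image_pred.
Proof. by move=> _ /image_predP[x ->]; rewrite -multV image_pred_mem. Qed.

HB.instance Definition _ := isMulClosed.Build B image_pred image_predM.
HB.instance Definition _ := isMul1Closed.Build B image_pred image_pred1.
HB.instance Definition _ := isInvClosed.Build B image_pred image_predV.

Definition corestrict (x : A) : subgroup image_pred :=
  Subgroup (image_pred_mem x).

Lemma corestrictM : {morph corestrict : x y / x * y}.
Proof. by move=> x y; apply: val_inj; rewrite gmulfM /= gmulfM. Qed.

HB.instance Definition _ :=
  isMultiplicative.Build A (subgroup image_pred) corestrict corestrictM.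

Lemma corestrict_bij : injective h -> bijective corestrict.
Proof.
move=> hI; have /choice[g gK] (y : subgroup image_pred) : exists x, h x = val y.
  by have /image_predP[x ->] := valP y; exists x.
exists g => [x|y]; first by apply: hI; rewrite gK.
by apply: val_inj; rewrite /= gK.
Qed.

End Image.

(** The group on the elements of a list [s] that exhausts [T], as a finite type.
    The proof [sT] is a parameter because it makes [s] closed under the
    operations of [T]. *)
Definition enum_group (T : groupType) (s : seq T) (sT : forall x, x \in s) :=
  seq_sub s.

Section EnumGroup.
Variables (T : groupType) (s : seq T) (sT : forall x, x \in s).
Local Notation E := (enum_group sT).
Let inE x : E := SeqSub (sT x).

HB.instance Definition _ := Finite.copy E (seq_sub s).
Let emul (x y : E) : E := inE (ssval x * ssval y).
Let eone : E := inE 1.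
Let einv (x : E) : E := inE (ssval x)^-1.
Let emulA : associative emul.
Proof. by move=> x y z; apply: val_inj => /=; rewrite mulgA. Qed.
Let emul1 : left_id eone emul.
Proof. by move=> x; apply: val_inj => /=; rewrite mul1g. Qed.
Let emulV : left_inverse eone einv emul.
Proof. by move=> x; apply: val_inj => /=; rewrite mulVg. Qed.
HB.instance Definition _ := Finite_isGroup.Build E emulA emul1 emulV.

Lemma enum_groupM : {morph inE : x y / x * y}.
Proof. by move=> x y; apply: val_inj. Qed.

Lemma finite_group_model : exists (gT : finGroupType) (f : T -> gT),
  {morph f : x y / x * y} /\ injective f.
Proof. by exists E, inE; split; [exact: enum_groupM|move=> x y []]. Qed.
End EnumGroup.

(** * Involutions in Hall's group and embeddings of dihedral groups *)

Definition multiplicative_of (A B : magmaType) (f : A -> B)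
    (fM : {morph f : x y / x * y}) : {multiplicative A -> B} :=
  HB.pack f (isMultiplicative.Build A B f fM).

(** Embed the product of the generated subgroup [P] and [C_2] in [H]; an
    automorphism of [H] that carries [P] to its copy pulls the generator of [C_2]
    back to the required involution. *)
Lemma Hall_new_involution (H : groupType) (s : seq H) : Hall_universal H ->
  exists x,
    [/\ x \notin generated s, x * x = 1 & {in s, forall y, commute x y}].
Proof.
move=> hallH; pose P : groupClosed H := generated s.
have finP : finite_set [set` P].
  exact: generated_finite (Hall_locally_finite hallH).
have /finite_seqP[t Pt] := finP.
pose e : seq (subgroup P) := pmap insub t.
have eT u : u \in e.
  by rewrite mem_pmap_sub; have : [set` P] (val u) := valP u; rewrite Pt.
have [gT [i [iM iI]]] := finite_group_model eT.
have [f] := Hall_embeds_finite hallH (gT * {perm bool})%type.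
pose c : {perm bool} := tperm true false.
have hM : {morph (fun u : subgroup P => f (i u, 1)) : x y / x * y}.
  by move=> u v; rewrite -gmulfM iM; congr (f _); congr pair; rewrite mulg1.
pose h := multiplicative_of hM.
have hI : injective h by move=> u v /(@emb_inj _ _ f) [/iI].
have finQ : finite_set [set` image_pred h].
  have -> : [set` image_pred h] = [set` map h e].
    apply/seteqP; split=> y /=.
      by move=> /image_predP[u ->]; exact: map_f.
    by case/mapP => u _ ->; exact: (image_pred_mem h u).
  exact: finite_seq.
have [alpha alpha_bij alphaE] :=
  Hall_isomorphisms_extend hallH finP finQ (corestrict_bij hI).
have alphaI := bij_inj alpha_bij.
have [beta _ alphaK] := alpha_bij; pose x := beta (f (1, c)).
have ax : alpha x = f (1, c) by rewrite /x alphaK.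
have c_neq1 : c != 1.
  by apply/eqP => /permP/(_ true); rewrite tpermL perm1.
exists x; split.
- apply/negP => Px; have := alphaE (Subgroup Px); rewrite /= ax.
  by move=> /(@emb_inj _ _ f) [_ /eqP]; rewrite (negPf c_neq1).
- apply: alphaI; rewrite gmulfM ax -gmulfM mult1 -[RHS](mult1 f).
  by congr (f _); congr pair; rewrite ?mulg1 //= tperm2.
- move=> y ys; have Py : y \in P by exact: generated_mem.
  apply: alphaI; rewrite !gmulfM ax; have /= -> := alphaE (Subgroup Py).
  by rewrite -!gmulfM; congr (f _); congr pair; rewrite /= ?mulg1 ?mul1g.
Qed.

(** The Klein four-group satisfies the relations of [D_n] for even [n]; the two
    characters are the components of the resulting map, read in [bool] through
    the sign of a permutation of two points. *)
Lemma dihedral_klein (m : nat) : (0 < m)%N ->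
  exists (a b : dihedral (2 * m)) (mu nu : dihedral (2 * m) -> bool),
    [/\ {morph mu : x y / x * y >-> x (+) y},
        {morph nu : x y / x * y >-> x (+) y},
        mu a = true /\ mu b = false & nu a = false /\ nu b = true].
Proof.
move=> m_gt0; pose V : finGroupType := ({perm bool} * {perm bool})%type.
pose c : {perm bool} := tperm true false.
pose u : V := (c, 1); pose v : V := (1, c).
have sq (x : V) : x ^+ 2 = (x.1 * x.1, x.2 * x.2) by [].
have u2 : u ^+ 2 = 1 by rewrite sq /= tperm2 mulg1.
have v2 : v ^+ 2 = 1 by rewrite sq /= tperm2 mulg1.
have uv2 : (u * v) ^+ 2 = 1 by rewrite sq /= mulg1 mul1g tperm2.
have vu2 : (v * u) ^+ 2 = 1 by rewrite sq /= mulg1 mul1g tperm2.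
have m2_gt1 : (1 < 2 * m)%N by rewrite mul2n -(prednK m_gt0) doubleS.
have : <[u]> <*> <[v]> \homg 'D_((2 * m).*2).
  rewrite (dihedral_presentation m2_gt1).
  by apply/existsP; exists (u, v); rewrite /= !expgM u2 v2 uv2 vu2 !expg1n.
case/homgP => psi psiE.
have ugen : u \in psi @* 'D_((2 * m).*2).
  by rewrite psiE (fintype.subsetP (joing_subl _ _)) ?cycle_id.
have vgen : v \in psi @* 'D_((2 * m).*2).
  by rewrite psiE (fintype.subsetP (joing_subr _ _)) ?cycle_id.
have [a _ _ ua] := morphimP ugen; have [b _ _ vb] := morphimP vgen.
exists a, b, (fun g => odd_perm (psi g).1), (fun g => odd_perm (psi g).2).
split; rewrite -?ua -?vb /= ?odd_perm1 ?odd_tperm //;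
  by move=> x y; rewrite morphM ?inE // odd_permM.
Qed.

(** The hypotheses on [P] and [Q] ensure that none of [u], [v] and [u * v] lies in
    [P], which contains the image of [f]. *)
Lemma twisted_embedding (H A : groupType) (f : embedding A H)
    (mu nu : A -> bool) (u v : H) (P Q : groupClosed H) :
    {morph mu : x y / x * y >-> x (+) y} ->
    {morph nu : x y / x * y >-> x (+) y} ->
    u * u = 1 -> v * v = 1 -> commute u v ->
    (forall x, commute u (f x)) -> (forall x, commute v (f x)) ->
    (forall x, f x \in P) -> {subset P <= Q} ->
    u \notin P -> u \in Q -> v \notin Q ->
  exists g : embedding A H, forall x, g x = u ^+ mu x * v ^+ nu x * f x.
Proof.
move=> muM nuM u2 v2 uv uf vf fP PQ uP uQ vQ.
have add2 (t : H) (b c : bool) : t * t = 1 -> t ^+ (b (+) c) = t ^+ b * t ^+ c.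
  by move=> t2; case: b; case: c; rewrite /= ?mulg1 ?mul1g // t2.
have gM : {morph (fun x => u ^+ mu x * v ^+ nu x * f x) : x y / x * y}.
  move=> x y; rewrite muM nuM !add2 // gmulfM.
  have c1 : commute (f x) (u ^+ mu y) by exact/commuteX/commute_sym.
  have c2 : commute (f x) (v ^+ nu y) by exact/commuteX/commute_sym.
  have c3 : commute (v ^+ nu x) (u ^+ mu y).
    by apply: commuteX; apply/commute_sym/commuteX.
  rewrite -!mulgA; congr (_ * _).
  rewrite [LHS]mulgA -c3 -mulgA; congr (_ * _).
  by rewrite [RHS]mulgA c1 -mulgA; congr (_ * _); rewrite !mulgA c2.
have expb (t : H) (b : bool) : t ^+ b = if b then t else 1 by case: b.
pose g := multiplicative_of gM.
have gI : injective g.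
  move=> x y gxy; apply: (@emb_inj _ _ f); apply: divg1_eq.
  rewrite -multV -gmulfM.
  have : g (x * y^-1) = 1 by rewrite gmulfM multV gxy mulgV.
  move: (x * y^-1) => t; rewrite /g /= !expb.
  case: (nu t) => /=.
    case: (mu t) => /=.
      move=> /(congr1 (fun z => u^-1 * (z * (f t)^-1))).
      rewrite mulgK mulKg mul1g => vE; move: vQ; rewrite vE gpredM ?gpredV //.
      exact: PQ.
    rewrite mul1g => /(congr1 (fun z => z * (f t)^-1)).
    rewrite mulgK mul1g => vE.
    by move: vQ; rewrite vE gpredV PQ.
  case: (mu t) => /=; rewrite ?mul1g // mulg1.
  move=> /(congr1 (fun z => z * (f t)^-1)); rewrite mulgK mul1g => uE.
  by move: uP; rewrite uE gpredV fP.
by exists (Embedding gI).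
Qed.

(** * Recurrence along an idempotent ultrafilter *)

Lemma countable_tower (H : groupType) :
    countable [set: H] -> locally_finite H ->
  exists K : nat -> groupClosed H,
    [/\ forall i, finite_set [set` K i],
        forall i j, (i <= j)%N -> {subset K i <= K j} &
        forall x, exists i, x \in K i].
Proof.
move=> /countable_injP[c cI] lfH.
have /choice[e eE] (n : nat) : exists y, forall x, c x = n -> x = y.
  have [[x xn]|no] := pselect (exists x, c x = n); last first.
    by exists 1 => x xn; case: no; exists x.
  by exists x => y yn; apply: cI; rewrite ?inE // yn.
pose s i := map e (iota 0 i).
exists (fun i => generated (s i) : groupClosed H); split=> [i|i j ij|x].
- exact: generated_finite.
- apply: generatedS => x /mapP[k]; rewrite mem_iota /= => ki ->.
  by apply: map_f; rewrite mem_iota /= (leq_trans ki).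
- exists (c x).+1; apply: generated_mem.
  rewrite [X in X \in _](eE _ x erefl) map_f //.
  by rewrite mem_iota add0n ltnSn.
Qed.

(** A map with finite range is constant on a member of the ultrafilter. *)
Lemma ultra_fiber (T : Type) (U : choiceType) (r : set_system T) (f : T -> U)
    (B : set U) : UltraFilter r -> finite_set B -> (forall x, B (f x)) ->
  exists c, r [set x | f x = c].
Proof.
move=> Ur /finite_seqP[s ->] fs.
have {fs} : r [set x | f x \in s] by apply: filterS filterT => x _; exact: fs.
elim: s => [|c s IH] rs.
  by have [x] := @filter_ex _ r _ _ rs.
have [rc|rc] := in_ultra_setVsetC [set x | f x = c] Ur; first by exists c.
apply: IH; apply: filterS (filterI rs rc) => x [/=].
by rewrite inE => /predU1P[].
Qed.

Section Limits.
Variables (G : groupType) (K : nat -> groupClosed G) (p : nat -> G -> G).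
Hypothesis pP : tower_projection K p.
Hypothesis Kfin : forall i, finite_set [set` K i].
Variable r : set_system G.
Hypothesis Ur : UltraFilter r.
Hypothesis rr : r `<=` filter_mul r r.

(** The limit [q] of the projections along [r]. Idempotence of [r] makes [q]
    recurrent: for [r]-most [z], [q j * z] still projects to [q i]. *)
Lemma tower_limit : exists q : nat -> G,
  [/\ forall i, r [set x | p i x = q i],
      forall i j, (i <= j)%N -> p i (q j) = q i &
      forall i, r [set z | forall j, (i <= j)%N -> z \in K j ->
                   p i (q j * z) = q i]].
Proof.
have /choice[q rq] (i : nat) : exists c, r [set x | p i x = c].
  by apply: ultra_fiber (Kfin i) _ => // x; exact: proj_in pP i x.
exists q; split=> // [i j ij|i].
  have [x [<- <-]] := filter_ex (filterI (rq i) (rq j)).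
  by rewrite (proj_proj pP).
apply: (@filterS _ r _ _ _ _ (rr (rq i))) => z rz j ij Kz.
have [x [/= <- <-]] := filter_ex (filterI rz (rq j)).
by rewrite -(projM pP) // (proj_proj pP).
Qed.
End Limits.

(** The involutions that centralize [s] and are not in the subgroup generated by
    [s]. *)
Definition involutions_off (H : groupType) (s : seq H) : set H :=
  [set x |
    [/\ x \notin generated s, x * x = 1 & {in s, forall y, commute x y}]].

Lemma involutions_offS (H : groupType) (s t : seq H) :
  {subset s <= t} -> involutions_off t `<=` involutions_off s.
Proof.
move=> st x [xt x2 xc]; split=> // [|y /st]; last exact: xc.
by apply: contraNN xt; exact: generatedS.
Qed.

(** The images under [w] of these sets of involutions generate a filter contained
    in its square: if [x] avoids [s] and [y] avoids [x :: s], then [y * x] avoids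
    [s]. *)
Lemma involutions_ultrafilter (H G : groupType) (w : embedding H G) :
    Hall_universal H ->
  exists r : set_system G, [/\ UltraFilter r, r `<=` filter_mul r r &
    forall s, r (w @` involutions_off s)].
Proof.
move=> hallH.
pose F := [set A : set G | exists s, w @` involutions_off s `<=` A].
have mF : mul_filter F.
  split.
    apply: Build_ProperFilter_ex.
      move=> A [s sA]; have [x xs] := Hall_new_involution s hallH.
      by exists (w x); apply: sA; exists x.
    split.
    - by exists [::].
    - move=> A B [s sA] [t tB]; exists (s ++ t) => _ [x xst <-]; split.
        apply: sA; exists x => //; apply: involutions_offS xst => y ys.
        by rewrite mem_cat ys.
      apply: tB; exists x => //; apply: involutions_offS xst => y ys.
      by rewrite mem_cat ys orbT.
    - by move=> A B AB [s sA]; exists s; exact: subset_trans AB.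
  move=> A [s sA]; exists s => _ [x [xs x2 xc] <-] /=; exists (x :: s).
  move=> _ [y [yxs y2 yc] <-] /=; rewrite -gmulfM; apply: sA.
  have yx : commute y x by apply: yc; exact: mem_head.
  exists (y * x) => //; split=> [||t ts].
  - apply: contraNN yxs => yxs.
    have -> : y = y * x * x^-1 by rewrite mulgK.
    apply: gpredM; last by rewrite gpredV generated_mem ?mem_head.
    by apply: generatedS yxs => t ts; rewrite inE ts orbT.
  - by rewrite mulgA -(mulgA y) -yx (mulgA y) y2 mul1g x2.
  - apply/commute_sym/commuteM; apply/commute_sym; last exact: xc.
    by apply: yc; rewrite inE ts orbT.
have [r [Ur Fr rr]] := idempotent_ultrafilter mF.
by exists r; split=> // s; apply: Fr; exists s.
Qed.

(** The terms are chosen recursively, each one avoiding the list [s n] of the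
    previous ones and of the elements of [s0]; [rho n] bounds the ranks of the
    images of this list. *)
Lemma block_sequence_exists (H G : groupType) (w : embedding H G)
    (K : nat -> groupClosed G) (p : nat -> G -> G) (s0 : seq H) :
    Hall_universal H -> tower_projection K p ->
    (forall i, finite_set [set` K i]) ->
    (forall i j, (i <= j)%N -> {subset K i <= K j}) ->
    (forall x, exists i, x \in K i) ->
  exists (q : nat -> G) (rho : nat -> nat) (x : nat -> H) (s : nat -> seq H),
    [/\ forall i j, (i <= j)%N -> p i (q j) = q i,
        block_sequence K p q rho (w \o x),
        s 0 = s0 /\ (forall n, s n.+1 = x n :: s n),
        forall n, involutions_off (s n) (x n) &
        forall n, {in s n, forall y, w y \in K (rho n)}].
Proof.
move=> hallH pP Kfin Kmono Kexh.
have [r [Ur rr rX]] := involutions_ultrafilter w hallH.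
have [q [rq q_coh r_ret]] := tower_limit pP Kfin Ur rr.
have /choice[rk rkP] := Kexh.
pose bound (s : seq H) := \max_(y <- s) rk (w y).
have /choice[next nextP] (s : seq H) : exists x,
    [/\ involutions_off s x, p (bound s) (w x) = q (bound s) &
        forall j, (bound s <= j)%N -> w x \in K j ->
          p (bound s) (q j * w x) = q (bound s)].
  have [_ [[x xs <-] [pq ret]]] :=
    filter_ex (filterI (rX s) (filterI (rq (bound s)) (r_ret (bound s)))).
  by exists x.
pose s n := iter n (fun t => next t :: t) s0.
have in_bound (t : seq H) : {in t, forall y, w y \in K (bound t)}.
  by move=> y yt; apply: Kmono (rkP _); exact: leq_bigmax_seq.
have s_mem m n : (m < n)%N -> next (s m) \in s n.
  elim: n => //= n IH; rewrite ltnS leq_eqVlt => /predU1P[->|/IH].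
    exact: mem_head.
  by rewrite inE => ->; rewrite orbT.
have off n : involutions_off (s n) (next (s n)) by case: (nextP (s n)).
exists q, (bound \o s), (next \o s), s; split=> //.
have mono n : (bound (s n) <= bound (s n.+1))%N.
  by rewrite /bound /= big_cons leq_maxr.
have inS n : w (next (s n)) \in K (bound (s n.+1)).
  by apply: in_bound; exact: mem_head.
split=> //= [n|n|n|m n].
- by case: (nextP (s n)).
- by case: (nextP (s n)) => _ _; apply.
- apply/eqP; rewrite -[RHS](mult1 w) => /(@emb_inj _ _ w) x1.
  by case: (off n); rewrite x1 gpred1.
- apply: gmulf_commute; case: (ltngtP m n) => [mn|nm|->//].
    by apply: commute_sym; case: (off n) => _ _; apply; exact: s_mem.
  by case: (off m) => _ _; apply; exact: s_mem.
Qed.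

(** * Big Ramsey degrees *)

Lemma mulg_involution (H : groupType) (x y : H) :
  x * x = 1 -> y * y = 1 -> commute x y -> (x * y) * (x * y) = 1.
Proof. by move=> x2 y2 xy; rewrite {1}xy mulgA -(mulgA y) x2 mulg1 y2. Qed.

Lemma select_involution (H : groupType) (x : nat -> H) S n :
    (forall m, x m * x m = 1) -> (forall m k, commute (x m) (x k)) ->
  select x S 1 n * select x S 1 n = 1.
Proof.
move=> x2 xx; elim: n => [|n IH] /=; first by rewrite mulg1.
case: (S n) => //; apply: mulg_involution => //.
by apply: commute_select => //; exact: commute1.
Qed.

Lemma select_morph (H G : groupType) (w : embedding H G) (x : nat -> H) S c n :
  w (select x S 1 n) * c = select (w \o x) S c n.
Proof.
elim: n => [|n IH] /=; first by rewrite mult1 mul1g.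
by case: (S n); rewrite ?gmulfM -?mulgA IH.
Qed.

(** Every copy of [H] in [H] meets all [n.+1] colours of the oscillation modulo
    [n.+1]. The group [A], exhausted by the list [e], is finite. *)
Lemma no_ramsey_bound (H A : groupType) (e : seq A) (f : embedding A H)
    (a b : A) (mu nu : A -> bool) n :
    Hall_universal H -> (forall x, x \in e) ->
    {morph mu : x y / x * y >-> x (+) y} ->
    {morph nu : x y / x * y >-> x (+) y} ->
    mu a = true /\ mu b = false -> nu a = false /\ nu b = true ->
  ~ ramsey_bound A H n.
Proof.
move=> hallH eA muM nuM [mua mub] [nua nub] [_ bound_n].
have lfH := Hall_locally_finite hallH.
have [K [Kfin Kmono Kexh]] := countable_tower (Hall_countable hallH) lfH.
have [p pP] := tower_projection_exists Kmono Kexh.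
have /choice[rk rkP] := Kexh.
pose value x y := osc p x y (maxn (rk x) (rk y)).
have valueE x y N : x \in K N -> y \in K N -> value x y = osc p x y N.
  move=> xN yN; pose N' := maxn N (maxn (rk x) (rk y)).
  rewrite /value -(osc_stable pP Kmono xN yN (leq_maxl _ (maxn (rk x) (rk y)))).
  rewrite -(osc_stable (N' := N') pP Kmono) ?leq_maxr //.
    by apply: Kmono (rkP x); exact: leq_maxl.
  by apply: Kmono (rkP y); exact: leq_maxr.
pose chi (g : embedding A H) : 'I_n.+1 := inord (value (g a) (g b) %% n.+1)%N.
have [//|w] := bound_n n.+1 chi.
suff -> : chi @` [set emb_comp w g | g in [set: embedding A H]] =
    [set: 'I_n.+1].
  by rewrite -(card_le_eql card_II) card_le_II ltnn.
apply/seteqP; split=> // i _.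
have [q [rho [x [s [q_coh zP [s0 sS] x_off s_in]]]]] :=
  block_sequence_exists w (map f e) hallH pP Kfin Kmono Kexh.
have s_x m k : (m < k)%N -> x m \in s k.
  elim: k => //= k IH; rewrite sS inE ltnS leq_eqVlt.
  by move=> /predU1P[->|/IH->]; rewrite ?eqxx ?orbT.
have s_f g k : f g \in s k.
  by elim: k => [|k IH]; rewrite ?s0 ?map_f // sS inE IH orbT.
have x2 m : x m * x m = 1 by case: (x_off m).
have xf m g : commute (x m) (f g) by case: (x_off m) => _ _; apply.
have xx m k : commute (x m) (x k).
  have xlt m' k' : (m' < k')%N -> commute (x k') (x m').
    by move=> mk; case: (x_off k') => _ _; apply; exact: s_x.
  by case: (ltngtP m k) => [/xlt/commute_sym|/xlt|->].
pose M := n.*2.+1.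
have f_in g : w (f g) \in K (rho 0) by apply: s_in.
have zf m g : commute ((w \o x) m) (w (f g)) by exact: gmulf_commute.
have [c oscE] := osc_words pP Kmono q_coh zP (f_in a) (f_in b) (zf^~ a)
  (erefl M) (leq_trans (block_mono zP M) (block_mono zP M.+1)).
(* The number [j <= n] of alternations that yields the colour [i]. *)
pose j := ((i + (n.+1 - c %% n.+1)) %% n.+1)%N.
have jn : (j <= n)%N by rewrite -ltnS ltn_mod.
have cj : ((c + j) %% n.+1 = i)%N.
  rewrite modnDmr addnCA -modnDmr -(modnDml c) subnKC; last first.
    by rewrite ltnW // ltn_mod.
  by rewrite modnn addn0 modn_small.
pose u := x M * select x (pattern j) 1 M.
pose v := x M.+1 * select x (negb \o pattern j) 1 M.
have sel_in S k : select x S 1 k \in generated (s k).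
  elim: k => [|k IH] /=; first exact: gpred1.
  have IH' : select x S 1 k \in generated (s k.+1).
    by apply: generatedS IH => y ys; rewrite sS inE ys orbT.
  by case: (S k) => //; rewrite gpredM // generated_mem // s_x.
have gen_step k : {subset generated (s k) <= generated (s k.+1)}.
  by apply: generatedS => y ys; rewrite sS inE ys orbT.
have sel_comm S y k : (forall m, commute y (x m)) -> commute y (select x S 1 k).
  by move=> yx; apply: commute_select => //; exact: commute1.
have u2 : u * u = 1.
  by apply: mulg_involution; rewrite ?select_involution //; exact: sel_comm.
have v2 : v * v = 1.
  by apply: mulg_involution; rewrite ?select_involution //; exact: sel_comm.
have ux m : commute u (x m).
  by apply/commute_sym/commuteM => //; exact: sel_comm.
have uv : commute u v by apply: commuteM => //; exact: sel_comm.
have comm_f S k g : commute (x k * select x S 1 M) (f g).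
  apply/commute_sym/commuteM; first exact/commute_sym.
  by apply: sel_comm => m; exact/commute_sym.
have uP : u \notin generated (s M).
  by rewrite gpredMr ?sel_in //; case: (x_off M).
have uQ : u \in generated (s M.+1).
  by rewrite gpredM ?(gen_step _ _ (sel_in _ _)) // generated_mem // s_x.
have vQ : v \notin generated (s M.+1).
  by rewrite gpredMr ?(gen_step _ _ (sel_in _ _)) //; case: (x_off M.+1).
have [g gE] := twisted_embedding (f := f) muM nuM u2 v2 uv
  (comm_f _ _) (comm_f _ _) (fun t => generated_mem (s_f t M)) (gen_step M) uP uQ vQ.
exists (emb_comp w g); first by exists g.
have ga : w (g a) = left_word (w \o x) (w (f a)) M (pattern j).
  rewrite gE mua nua /= mulg1 /left_word -select_morph.
  by rewrite !gmulfM -!mulgA.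
have gb : w (g b) = right_word (w \o x) (w (f b)) M (pattern j).
  rewrite gE mub nub /= mul1g /right_word -select_morph.
  by rewrite !gmulfM -!mulgA.
apply: val_inj; rewrite /chi /= inordK ?ltn_mod // ga gb.
rewrite (valueE _ _ (rho M.+2)) ?oscE ?cj //.
  rewrite gpredM //.
    by apply: Kmono (block_in zP M); exact: block_mono zP _.
  apply: Kmono (select_in Kmono zP _ (f_in a) M).
  exact: leq_trans (block_mono zP M) (block_mono zP M.+1).
rewrite gpredM ?(block_in zP) //.
apply: Kmono (select_in Kmono zP _ (f_in b) M).
exact: leq_trans (block_mono zP M) (block_mono zP M.+1).
Qed.

Lemma big_ramsey_degree_infinite (A S : groupType) :
  (forall n, ~ ramsey_bound A S n) -> big_ramsey_degree A S = None.
Proof.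
move=> noA; rewrite /big_ramsey_degree; case: pselect => // ex.
by have [n /asboolP /noA] := ex.
Qed.

Theorem theorem4p3 (H : groupType) (hallH : Hall_universal H) :
  (forall m : nat, 0 < m -> big_ramsey_degree (dihedral (2 * m)) H = None) /\
  ~ finite_big_ramsey_degrees H.
Proof.
split=> [m m_gt0|finH].
  have [a [b [mu [nu [muM nuM mab nab]]]]] := dihedral_klein m_gt0.
  have [f] := Hall_embeds_finite hallH (dihedral (2 * m)).
  apply: big_ramsey_degree_infinite => n.
  by apply: (no_ramsey_bound f hallH (@mem_enum _ _) muM nuM mab nab).
have [a [b [mu [nu [muM nuM mab nab]]]]] := dihedral_klein (ltn0Sn 0).
set D := dihedral _ in a b mu nu muM nuM mab nab.
have [f] := Hall_embeds_finite hallH D.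
pose P : groupClosed H := image_pred f.
have fgP : finitely_generated P.
  exists (map f (enum D)); split=> [y /mapP[d _ ->]|Q eQ y].
    exact: image_pred_mem.
  rewrite /P => yf; have /image_predP[d ->] := yf.
  by apply: eQ; rewrite map_f // mem_enum.
have valM : {morph (fun y : subgroup P => val y) : x y / x * y} by [].
have valI : injective (multiplicative_of valM) by exact: val_inj.
have [h hK Kh] := corestrict_bij (@emb_inj _ _ f).
have hM : {morph h : x y / x * y}.
  by apply: can2_gmulfM hK Kh.
apply: (finH P fgP); apply: big_ramsey_degree_infinite => n.
have eP (y : subgroup P) : y \in map (corestrict f) (enum D).
  by rewrite -[y]Kh map_f // mem_enum.
apply: (no_ramsey_bound (a := corestrict f a) (b := corestrict f b)
  (mu := mu \o h) (nu := nu \o h) (Embedding valI) hallH eP).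
- by move=> x y /=; rewrite hM muM.
- by move=> x y /=; rewrite hM nuM.
- by rewrite /= !hK.
- by rewrite /= !hK.
Qed.
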